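(* Consider the uncensored delayed-feedback bandit model (described in the context), with conversion rates $\theta=(\theta_1,\dots,\theta_K)\in(0,1)^K$ such that arm $1$ is the unique optimal arm ($\theta^*:=\theta_1>\theta_k$ for all $k\neq1$), and with a delay distribution having finite expectation $\mu=\mathbb{E}[D]<\infty$. Then every uniformly efficient algorithm satisfies \[ \liminf_{T\to\infty}\frac{L(T)}{\log T}\;\ge\;\sum_{k\neq 1}\frac{\theta^*-\theta_k}{d(\theta_k,\theta^* )} . \]
   Context: Delayed-feedback bandit model: there are $K$ arms with unknown conversion rates $\theta_1,\dots,\theta_K\in[0,1]$, and a known delay distribution on $\mathbb{N}=\{0,1,2,\dots\}$ with CDF $\tau_d=\mathbb{P}(D\le d)$. At each round $t=1,2,\dots$ the learner chooses an arm $A_t\in\{1,\dots,K\}$ as a function of the observations available before round $t$. This triggers $C_t\in\{0,1\}$ and $D_t\in\mathbb{N}$ which, conditionally on the past, are independent, with $C_t\sim\mathrm{Bernoulli}(\theta_{A_t})$ and $D_t$ distributed with CDF $\tau$. For $s\le t$ let $X_{s,t}=C_s\mathbf{1}\{D_s\le t-s\}$. In the uncensored model, at round $t$ the learner observes all $X_{s,t}$, $1\le s\le t$, and receives reward $Y_t=\sum_{s=1}^{t}C_s\mathbf{1}\{D_s=t-s\}$. The expected regret is $L(T)=\mathbb{E}[r^*(T)-r(T)]$ where $r(T)=\sum_{t=1}^TY_t$ and $r^*(T)$ is the cumulated reward of an oracle playing the optimal arm at every round. An algorithm is uniformly efficient if for every bandit model and every $\alpha\in(0,1)$, $L(T)/T^\alpha\to0$.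 $d(p,q)=p\log(p/q)+(1-p)\log((1-p)/(1-q))$ is the Bernoulli Kullback–Leibler divergence. *)

(* Defs.v *)
From HB Require Import structures.
From mathcomp Require Import all_boot all_order all_algebra.
From mathcomp Require Import all_classical all_reals all_analysis.
Set Implicit Arguments. Unset Strict Implicit. Unset Printing Implicit Defensive.
Import Order.TTheory GRing.Theory Num.Theory.
Import numFieldNormedType.Exports.
Local Open Scope classical_set_scope.
Local Open Scope ring_scope.

(* A history of the first T rounds is a sequence h of size T whose i-th
   element (0-based) is the pair (C_{i+1}, D_{i+1}).  Rounds are 1-based. *)
Definition round_of (h : seq (bool * nat)) (s : nat) : bool * nat :=
  nth (false, 0%N) h s.-1.

Definition Xobs (h : seq (bool * nat)) (s t : nat) : bool :=
  (round_of h s).1 && ((round_of h s).2 <= t - s)%N.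

Definition obs_round (h : seq (bool * nat)) (t : nat) : seq bool :=
  [seq Xobs h s t | s <- iota 1 t].

Definition obs_before (h : seq (bool * nat)) (t : nat) : seq (seq bool) :=
  [seq obs_round h t' | t' <- iota 1 t.-1].

Definition policy (K : nat) := seq (seq bool) -> 'I_K.+1.

Definition action K (pol : policy K) (h : seq (bool * nat)) (t : nat) : 'I_K.+1 :=
  pol (obs_before h t).

Definition bern {R : realType} (q : R) (c : bool) : R := if c then q else 1 - q.

(* probability (mass) of the history h of the first size h rounds, when the
   algorithm pol runs in the model with conversion rates th and delay pmf p
   (tau_d = \sum_{i <= d} p i): chain rule, C_t ~ Bern(th_{A_t}) and
   D_t ~ p independent conditionally on the past. *)
Definition hist_prob {R : realType} K (th : 'I_K.+1 -> R) (p : nat -> R)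
    (pol : policy K) (h : seq (bool * nat)) : R :=
  \prod_(1 <= t < (size h).+1)
     (bern (th (action pol h t)) (round_of h t).1 * p (round_of h t).2).

Definition Yrew {R : realType} (h : seq (bool * nat)) (t : nat) : R :=
  \sum_(1 <= s < t.+1)
     ((round_of h s).1 && ((round_of h s).2 == t - s)%N)%:R.

Definition cumrew {R : realType} (h : seq (bool * nat)) (T : nat) : R :=
  \sum_(1 <= t < T.+1) Yrew h t.

Definition exp_reward {R : realType} K (th : 'I_K.+1 -> R) (p : nat -> R)
    (pol : policy K) (T : nat) : \bar R :=
  \esum_(h in [set h : seq (bool * nat) | size h = T])
     (hist_prob th p pol h * cumrew h T)%:E.

Definition opt_arm {R : realType} K (th : 'I_K.+1 -> R) : 'I_K.+1 :=
  [arg max_(k > ord0) th k]%O.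

Definition oracle {R : realType} K (th : 'I_K.+1 -> R) : policy K :=
  fun _ => opt_arm th.

(* expected regret L(T) = E[r*(T)] - E[r(T)] (both expectations are finite) *)
Definition regret {R : realType} K (th : 'I_K.+1 -> R) (p : nat -> R)
    (pol : policy K) (T : nat) : R :=
  fine (exp_reward th p (oracle th) T) - fine (exp_reward th p pol T).

(* uniform efficiency (delay distribution p fixed and known) *)
Definition uniformly_efficient {R : realType} K (p : nat -> R) (pol : policy K) :=
  forall th : 'I_K.+1 -> R, (forall k, 0 <= th k <= 1) ->
  forall alpha : R, 0 < alpha < 1 ->
    (fun T : nat => regret th p pol T / (T%:R `^ alpha)) @ \oo --> (0 : R).

Definition klBern {R : realType} (x y : R) : R :=
  x * ln (x / y) + (1 - x) * ln ((1 - x) / (1 - y)).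

(* Main.v *)
(* Since each delayed reward is lost only through the tail of the delay
   distribution, the regret up to time T is, up to the mean delay, the
   delay-free regret sum_k (th* - th_k) E[N_k(T)].  Revealing all the pairs
   (C_t, D_t) only adds information, and the delays cancel in likelihood ratios,
   so the Lai-Robbins change of measure applies to full histories: raise the
   rate of a suboptimal arm k to lam > th*, and let Z = 1 - N_k(T) / T, which is
   small in mean under the modified model by uniform efficiency.  Integrating
   1 + u <= exp u at u = a Z - llr, with exp (a z) <= 1 + z (exp a - 1), gives
     a E[Z] <= exp a * E'[Z] + kl(th_k, lam) E[N_k(T)];
   take a = (1 - alpha) ln T, then alpha -> 0 and lam -> th*. *)
Require Import Defs.
From HB Require Import structures.
From mathcomp Require Import all_boot all_order all_algebra.
From mathcomp Require Import all_classical all_reals all_analysis.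
From mathcomp Require Import ring lra zify.
Import Order.TTheory GRing.Theory Num.Theory.
Import numFieldNormedType.Exports.
Local Open Scope classical_set_scope.
Local Open Scope ring_scope.

Set Implicit Arguments.
Unset Strict Implicit.
Unset Printing Implicit Defensive.

(** * Sums of nonnegative families over countable sets *)

Lemma esumZ_le (R : realType) (T : choiceType) (I : set T) (a : T -> \bar R)
    (c : R) : 0 < c -> (forall i, (0 <= a i)%E) ->
  (\esum_(i in I) (c%:E * a i) <= c%:E * \esum_(i in I) a i)%E.
Proof.
move=> c0 a0; apply: ge_ereal_sup => /= _ [X [finX XI] <-].
rewrite -ge0_mule_fsumr // lee_pmul2l // ?fin_numE //; apply: ereal_sup_ubound.
by exists X.
Qed.

Lemma esumZ (R : realType) (T : choiceType) (I : set T) (a : T -> \bar R)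
    (c : R) : 0 <= c -> (forall i, (0 <= a i)%E) ->
  (\esum_(i in I) (c%:E * a i) = c%:E * \esum_(i in I) a i)%E.
Proof.
rewrite le_eqVlt => /orP[/eqP <- _|c0 a0].
  by rewrite mul0e esum1 // => i _; rewrite mul0e.
apply/eqP; rewrite eq_le esumZ_le //=.
have ac0 i : (0 <= c%:E * a i)%E by rewrite mule_ge0 // lee_fin ltW.
(* The converse inequality is [esumZ_le] again, for the family [c * a] rescaled by [c^-1]. *)
have := @esumZ_le _ _ I _ c^-1 _ ac0; rewrite invr_gt0 => /(_ c0).
under eq_esum => i _ do rewrite muleA -EFinM mulVf ?gt_eqF // mul1e.
by rewrite -(@lee_pmul2l _ c%:E) // ?lte_fin // muleA -EFinM divff ?gt_eqF // mul1e.
Qed.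

(** Appending a last round is a bijection from pairs (history of length [n], outcome) to histories
    of length [n.+1]. This is what allows conditioning on the first [n] rounds. *)
Lemma esum_seq_rcons (R : realType) (X : choiceType) n
    (F : seq X -> \bar R) : (forall h, (0 <= F h)%E) ->
  \esum_(h in [set h | size h = n.+1]) F h =
  \esum_(h in [set h | size h = n]) \esum_(x in [set: X]) F (rcons h x).
Proof.
move=> F0; rewrite esum_esum //.
rewrite (reindex_esum ([set h | size h = n] `*`` (fun=> [set: X])) _
  (fun hx => rcons hx.1 hx.2)) //; split.
- by move=> [h x] [/= hn _]; rewrite size_rcons hn.
- move=> [h x] [h' x'] _ _ /= /eqP; rewrite eqseq_rcons => /andP[].
  by move=> /eqP -> /eqP ->.
- move=> h /=; elim/last_ind: h => // h x _; rewrite size_rcons => -[hn].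
  by exists (h, x).
Qed.

Lemma esum_bool_nat (R : realType) (F : bool * nat -> \bar R) :
  (forall x, (0 <= F x)%E) ->
  (\esum_(x in [set: bool * nat]) F x =
   \esum_(d in [set: nat]) F (true, d) + \esum_(d in [set: nat]) F (false, d))%E.
Proof.
have finB : finite_set [set: bool] by exact: finite_finset.
move=> F0; pose a (d : nat) (c : bool) := F (c, d).
rewrite -esumD //.
transitivity (\esum_(d in [set: nat]) \esum_(c in [set: bool]) a d c).
  rewrite esum_esum; last by move=> *; exact: F0.
  rewrite (reindex_esum ([set: nat] `*`` (fun=> [set: bool])) _
    (fun dc => (dc.2, dc.1))) //; split => //.
  - by move=> [d c] [d' c'] _ _ /= [-> ->].
  - by move=> [c d] _; exists (d, c).
apply: eq_esum => d _; rewrite esum_fset //; last by move=> c _; exact: F0.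
rewrite fsbig_finite //= (perm_big [:: true; false]) /=.
  by rewrite !big_cons big_nil adde0.
apply: uniq_perm; rewrite ?finmap.fset_uniq // => c; rewrite in_fset_set //.
by rewrite !inE; case: c; rewrite mem_set.
Qed.

Lemma esum_cvg_series (R : realType) (u : nat -> R) (l : R) :
  (forall n, 0 <= u n) -> series u @ \oo --> l ->
  \esum_(n in [set: nat]) (u n)%:E = l%:E.
Proof.
move=> u0 ul; rewrite -nneseries_esumT //.
apply/cvg_lim => //.
have -> : (fun n => \sum_(0 <= i < n) (u i)%:E)%E = EFin \o series u.
  by apply/funext => n /=; rewrite sumEFin.
by apply: cvg_EFin; [exact: nearW|exact: ul].
Qed.

(** * The law of histories and expectations under it *)

Section HistoryLaw.
Context {R : realType} {K : nat}.
Variables (p : nat -> R) (pol : policy K).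
Hypothesis p_ge0 : forall d, 0 <= p d.
Implicit Types (th : 'I_K.+1 -> R) (h : seq (bool * nat)) (F G : seq (bool * nat) -> R).

Lemma round_of_rcons h x s : (0 < s <= size h)%N ->
  round_of (rcons h x) s = round_of h s.
Proof. by case: s => // s /andP[_ sh]; rewrite /round_of /= nth_rcons sh. Qed.

Lemma round_of_rcons_last h x : round_of (rcons h x) (size h).+1 = x.
Proof. by rewrite /round_of /= nth_rcons ltnn eqxx. Qed.

(** The policy is adapted: at round [t] it reads only rounds [s <= t' < t], all inside [h]. The
    bound includes the round being appended, whose arm is therefore fixed by the past. *)
Lemma action_rcons h x t : (t <= (size h).+1)%N ->
  action pol (rcons h x) t = action pol h t.
Proof.
move=> th; rewrite /action /obs_before; congr pol.
apply/eq_in_map => t'; rewrite mem_iota => t'P; apply/eq_in_map => s.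
by rewrite mem_iota => sP; rewrite /Xobs round_of_rcons //; lia.
Qed.

Lemma hist_prob_rcons th h x : hist_prob th p pol (rcons h x) =
  hist_prob th p pol h *
  (bern (th (action pol h (size h).+1)) x.1 * p x.2).
Proof.
rewrite /hist_prob size_rcons big_nat_recr //= action_rcons //.
rewrite round_of_rcons_last; congr (_ * _); apply: eq_big_nat => t tP.
by rewrite action_rcons ?round_of_rcons //; lia.
Qed.

Definition rates th := forall k, 0 <= th k <= 1.

Lemma bern_ge0 (q : R) c : 0 <= q <= 1 -> 0 <= bern q c.
Proof. by case: c => /= /andP[? ?] //; rewrite subr_ge0. Qed.

Lemma hist_prob_ge0 th h : rates th -> 0 <= hist_prob th p pol h.
Proof.
by move=> th01; apply: prodr_ge0 => t _; rewrite mulr_ge0 // bern_ge0.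
Qed.

(* The sum is finite, and [fine] harmless, as soon as [F] is bounded. *)
Definition hist_mean th n F : R :=
  fine (\esum_(h in [set h | size h = n]) (hist_prob th p pol h * F h)%:E).

(** The class on which [hist_mean] is linear and monotone: nonnegativity suits [esum], and a bound
    keeps the sum finite because the total mass is 1. *)
Definition bounded_ge0 F := exists B, forall h, 0 <= F h <= B.

Lemma bounded_ge0_ge F h : bounded_ge0 F -> 0 <= F h.
Proof. by case=> B /(_ h) /andP[]. Qed.

Lemma bounded_ge0_cst (c : R) : 0 <= c -> bounded_ge0 (fun=> c).
Proof. by move=> c0; exists c => h; rewrite c0 lexx. Qed.

Lemma bounded_ge0D F G : bounded_ge0 F -> bounded_ge0 G ->
  bounded_ge0 (fun h => F h + G h).
Proof.
move=> [B FB] [C GC]; exists (B + C) => h.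
by have := FB h; have := GC h; lra.
Qed.

Lemma bounded_ge0M F G : bounded_ge0 F -> bounded_ge0 G ->
  bounded_ge0 (fun h => F h * G h).
Proof.
move=> [B FB] [C GC]; exists (B * C) => h.
have /andP[F0 FB'] := FB h; have /andP[G0 GC'] := GC h.
by rewrite mulr_ge0 // ler_pM.
Qed.

Lemma bounded_ge0_sum (I : eqType) (r : seq I) (f : I -> seq (bool * nat) -> R) :
  (forall i, i \in r -> bounded_ge0 (f i)) ->
  bounded_ge0 (fun h => \sum_(i <- r) f i h).
Proof.
elim: r => [|i r IH] H.
  by under eq_fun do rewrite big_nil; exact: bounded_ge0_cst.
under eq_fun do rewrite big_cons; apply: bounded_ge0D.
  by apply: H; rewrite inE eqxx.
by apply: IH => j jr; apply: H; rewrite inE jr orbT.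
Qed.

Lemma bounded_ge0_bool (b : seq (bool * nat) -> bool) :
  bounded_ge0 (fun h => (b h)%:R).
Proof. by exists 1 => h; case: (b h); rewrite ?lexx ler01. Qed.

Variable th : 'I_K.+1 -> R.
Hypothesis th01 : rates th.

Let P0 h : 0 <= hist_prob th p pol h. Proof. exact: hist_prob_ge0. Qed.

(** The tower rule over the last round. Given the first [n] rounds its arm is known and its
    conversion and delay are independent, so the product [v * w] integrates to the Bernoulli mean of
    [v] times the delay mean [W] of [w]. *)
Lemma esum_hist_rcons n F G (v : bool -> R) (w : nat -> R) (W : R) :
  (forall h, 0 <= F h) -> (forall h, 0 <= G h) ->
  (forall c, 0 <= v c) -> (forall d, 0 <= w d) ->
  series (fun d => p d * w d) @ \oo --> W ->
  (forall h x, size h = n -> F (rcons h x) = G h * (v x.1 * w x.2)) ->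
  \esum_(h in [set h | size h = n.+1]) (hist_prob th p pol h * F h)%:E =
  \esum_(h in [set h | size h = n]) (hist_prob th p pol h *
     (G h * (W * (th (action pol h n.+1) * v true +
                 (1 - th (action pol h n.+1)) * v false))))%:E.
Proof.
move=> F0 G0 v0 w0 wW FG.
rewrite esum_seq_rcons; last by move=> h; rewrite lee_fin mulr_ge0.
apply: eq_esum => h /= hn.
rewrite esum_bool_nat; last by move=> x; rewrite lee_fin mulr_ge0.
have E c : \esum_(d in [set: nat])
    (hist_prob th p pol (rcons h (c, d)) * F (rcons h (c, d)))%:E =
  ((hist_prob th p pol h * G h * bern (th (action pol h n.+1)) c * v c) * W)%:E.
  rewrite EFinM -(@esum_cvg_series _ (fun d => p d * w d) W _ wW); last first.
    by move=> d; rewrite mulr_ge0.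
  rewrite -esumZ.
  - apply: eq_esum => d _; rewrite -EFinM hist_prob_rcons FG // hn /=.
    by congr EFin; ring.
  - by rewrite !mulr_ge0 // bern_ge0.
  - by move=> d; rewrite lee_fin mulr_ge0.
by rewrite !E -EFinD /=; congr EFin; ring.
Qed.

Hypothesis p_sum1 : series p @ \oo --> (1 : R).

Lemma esum_hist0 (F : seq (bool * nat) -> \bar R) : (forall h, (0 <= F h)%E) ->
  \esum_(h in [set h | size h = 0%N]) F h = F [::].
Proof.
move=> F0; have -> : [set h : seq (bool * nat) | size h = 0%N] = [set [::]].
  by apply/seteqP; split => h /=; [move/eqP; rewrite size_eq0 => /eqP|move=> ->].
by rewrite esum_set1.
Qed.

(** Consistency of the laws at different horizons: integrating out a round on which [F] does not
    depend gives a factor 1, the tower rule with [v = w = 1]. *)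
Lemma esum_hist_stable m n F : (forall h, 0 <= F h) -> (m <= n)%N ->
  (forall h x, (m <= size h)%N -> F (rcons h x) = F h) ->
  \esum_(h in [set h | size h = n]) (hist_prob th p pol h * F h)%:E =
  \esum_(h in [set h | size h = m]) (hist_prob th p pol h * F h)%:E.
Proof.
move=> F0 mn FS; elim: n mn => [|n IH]; first by rewrite leqn0 => /eqP ->.
rewrite leq_eqVlt => /orP[/eqP -> //|]; rewrite ltnS => mn; rewrite -(IH mn).
rewrite (@esum_hist_rcons n F F (fun=> 1) (fun=> 1) 1) //.
- by apply: eq_esum => h _; congr EFin; ring.
- by under eq_fun do rewrite mulr1.
- by move=> h x hn; rewrite FS ?hn // !mulr1.
Qed.

Lemma esum_hist_prob n :
  \esum_(h in [set h | size h = n]) (hist_prob th p pol h)%:E = 1%E.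
Proof.
have := @esum_hist_stable 0 n (fun=> 1) (fun=> ler01) (leq0n _) (fun _ _ _ => erefl).
rewrite esum_hist0 => [|h]; last by rewrite lee_fin mulr_ge0.
under eq_esum do rewrite mulr1.
by move=> ->; rewrite /hist_prob big_geq // mulr1.
Qed.

Lemma esum_hist_fin n F : bounded_ge0 F ->
  \esum_(h in [set h | size h = n]) (hist_prob th p pol h * F h)%:E \is a fin_num.
Proof.
move=> [B FB]; have B0 : 0 <= B by have /andP[/le_trans] := FB [::]; exact.
rewrite ge0_fin_numE; last first.
  by apply: esum_ge0 => h _; rewrite lee_fin mulr_ge0 //; case/andP: (FB h).
apply: (@le_lt_trans _ _ B%:E); last exact: ltry.
rewrite -[B%:E]mule1 -(esum_hist_prob n) -esumZ //.
apply: le_esum => h _; rewrite -EFinM lee_fin mulrC ler_wpM2r //.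
by case/andP: (FB h).
Qed.

Lemma hist_mean_stable m n F : (forall h, 0 <= F h) -> (m <= n)%N ->
  (forall h x, (m <= size h)%N -> F (rcons h x) = F h) ->
  hist_mean th n F = hist_mean th m F.
Proof. by move=> F0 mn FS; rewrite /hist_mean (esum_hist_stable F0 mn FS). Qed.

Lemma hist_mean_rcons n F G (v : bool -> R) (w : nat -> R) (W : R) :
  (forall h, 0 <= F h) -> (forall h, 0 <= G h) ->
  (forall c, 0 <= v c) -> (forall d, 0 <= w d) ->
  series (fun d => p d * w d) @ \oo --> W ->
  (forall h x, size h = n -> F (rcons h x) = G h * (v x.1 * w x.2)) ->
  hist_mean th n.+1 F =
  hist_mean th n (fun h => G h * (W * (th (action pol h n.+1) * v true +
                           (1 - th (action pol h n.+1)) * v false))).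
Proof.
by move=> F0 G0 v0 w0 wW FG; rewrite /hist_mean (esum_hist_rcons F0 G0 v0 w0 wW FG).
Qed.

Lemma eq_hist_mean n F G : (forall h, size h = n -> F h = G h) ->
  hist_mean th n F = hist_mean th n G.
Proof.
by move=> FG; rewrite /hist_mean; congr fine; apply: eq_esum => h /= /FG ->.
Qed.

Lemma hist_mean_cst n (c : R) : 0 <= c -> hist_mean th n (fun=> c) = c.
Proof.
move=> c0; rewrite /hist_mean.
under eq_esum => h _ do rewrite mulrC EFinM.
by rewrite esumZ // esum_hist_prob mule1.
Qed.

Lemma hist_meanD n F G : bounded_ge0 F -> bounded_ge0 G ->
  hist_mean th n (fun h => F h + G h) = hist_mean th n F + hist_mean th n G.
Proof.
move=> bF bG; rewrite /hist_mean.
under eq_esum => h _ do rewrite mulrDr EFinD.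
rewrite esumD; try by move=> h _; rewrite lee_fin mulr_ge0 // bounded_ge0_ge.
by rewrite fineD // esum_hist_fin.
Qed.

Lemma hist_meanZ n (c : R) F : 0 <= c -> bounded_ge0 F ->
  hist_mean th n (fun h => c * F h) = c * hist_mean th n F.
Proof.
move=> c0 bF; rewrite /hist_mean.
under eq_esum => h _ do rewrite mulrCA EFinM.
rewrite esumZ //; first by rewrite fineM // esum_hist_fin.
by move=> h; rewrite lee_fin mulr_ge0 // bounded_ge0_ge.
Qed.

Lemma le_hist_mean n F G : bounded_ge0 F -> bounded_ge0 G ->
  (forall h, size h = n -> F h <= G h) -> hist_mean th n F <= hist_mean th n G.
Proof.
move=> bF bG FG; rewrite /hist_mean fine_le ?esum_hist_fin //.
by apply: le_esum => h /= hn; rewrite lee_fin ler_wpM2l // FG.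
Qed.

Lemma hist_mean_ge0 n F : bounded_ge0 F -> 0 <= hist_mean th n F.
Proof.
move=> bF; rewrite -(hist_mean_cst n (lexx 0)).
apply: le_hist_mean => // [|h _]; first exact: bounded_ge0_cst.
exact: bounded_ge0_ge.
Qed.

Lemma hist_mean_sum n (I : eqType) (r : seq I) (f : I -> seq (bool * nat) -> R) :
  (forall i, i \in r -> bounded_ge0 (f i)) ->
  hist_mean th n (fun h => \sum_(i <- r) f i h) =
  \sum_(i <- r) hist_mean th n (f i).
Proof.
elim: r => [|i r IH] H.
  under eq_fun do rewrite big_nil.
  by rewrite hist_mean_cst // big_nil.
have Hr j : j \in r -> bounded_ge0 (f j) by move=> jr; apply: H; rewrite inE jr orbT.
under eq_fun do rewrite big_cons.
rewrite hist_meanD ?big_cons ?IH //; first by apply: H; rewrite inE eqxx.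
exact: bounded_ge0_sum.
Qed.

End HistoryLaw.

(** * Cumulated reward and the tail of the delay distribution *)

Lemma cumrewE (R : realType) (h : seq (bool * nat)) T :
  cumrew h T = \sum_(1 <= s < T.+1)
    ((round_of h s).1 && ((round_of h s).2 <= T - s)%N)%:R :> R.
Proof.
elim: T => [|T IH]; first by rewrite /cumrew !big_geq.
rewrite /cumrew big_nat_recr //= -/(cumrew h T) IH /Yrew.
rewrite [in RHS]big_nat_recr //= [X in _ + X]big_nat_recr //= addrA.
rewrite -big_split /= subnn leqn0; congr (_ + _).
(* A conversion of round [s] is paid exactly once, at round [s + D_s]: delay at most [T.+1 - s]
   splits into the disjoint cases at most [T - s] and equal to [T.+1 - s]. *)
apply: eq_big_nat => s sT; rewrite subSn; last by lia.
by case: (round_of h s) => -[] d /=; rewrite -natrD //; congr (_%:R); lia.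
Qed.

(** The limit is the CDF at [m]: [series p m.+1] sums the indices 0 to [m], hence the shift by one
    wherever the CDF appears. *)
Lemma cvg_series_le (R : realType) (p : nat -> R) m :
  series (fun d => p d * (d <= m)%N%:R) @ \oo --> series p m.+1.
Proof.
apply: cvg_near_cst; near=> n; rewrite !seriesEnat.
have mn : (m < n)%N by near: n; exact: nbhs_infty_gt.
rewrite /= (big_cat_nat _ mn) //= [X in _ + X]big_nat [X in _ + X]big1.
  by rewrite addr0; apply: eq_big_nat => i; rewrite andTb ltnS => ->; rewrite mulr1.
by move=> i /andP[mi _]; rewrite leqNgt mi mulr0.
Unshelve. all: by end_near. Qed.

(** Truncated form of E[D] = sum_j P(D > j): the mass [p d] is counted once for each [j < d]. *)
Lemma sum_tail (R : realType) (p : nat -> R) n :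
  \sum_(0 <= j < n) (series p n - series p j.+1) =
  series (fun d => d%:R * p d) n.
Proof.
elim: n => [|n IH]; first by rewrite /series /= !big_geq.
rewrite big_nat_recr //= subrr addr0 [RHS]seriesSr -IH.
have -> : n%:R * p n = \sum_(0 <= j < n) p n.
  by rewrite sumr_const_nat subn0 mulr_natl.
rewrite -big_split /=; apply: eq_bigr => j _.
by rewrite seriesSr; ring.
Qed.

Lemma sum_tail_le_mean (R : realType) (p : nat -> R) (n : nat) :
  (forall d, 0 <= p d) -> series p @ \oo --> (1 : R) ->
  cvg (series (fun d => d%:R * p d) @ \oo) ->
  \sum_(0 <= j < n) (1 - series p j.+1) <=
  lim (series (fun d => d%:R * p d) @ \oo).
Proof.
move=> p0 p1 pm.
have nd : nondecreasing_seq (series p) by apply: nondecreasing_series => *.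
have sumE (x : R) : \sum_(0 <= j < n) (x - series p j.+1) =
    n%:R * x - \sum_(0 <= j < n) series p j.+1.
  by rewrite sumrB sumr_const_nat subn0 mulr_natl.
have H : (fun m => \sum_(0 <= j < n) (series p m - series p j.+1)) @ \oo -->
    \sum_(0 <= j < n) (1 - series p j.+1).
  under eq_fun do rewrite sumE; rewrite sumE.
  by apply: cvgB; [apply: cvgM => //|]; exact: cvg_cst.
apply: (ler_cvg_to H pm).
(* With total mass 1 replaced by the partial mass up to [m >= n], the tails [j < n] are part of a
   sum of nonnegative tails [j < m], which [sum_tail] identifies. *)
near=> m; rewrite -sum_tail.
have nm : (n <= m)%N by near: m; exact: nbhs_infty_ge.
rewrite (big_cat_nat _ nm) //= lerDl big_nat; apply: sumr_ge0 => j /andP[_ jm].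
by rewrite subr_ge0 nd.
Unshelve. all: by end_near. Qed.

(** * Regret in terms of expected numbers of plays *)

Section Regret.
Context {R : realType} {K : nat}.
Variable p : nat -> R.
Hypothesis p_ge0 : forall d, 0 <= p d.
Hypothesis p_sum1 : series p @ \oo --> (1 : R).

Section Plays.
Variables (pol : policy K) (th : 'I_K.+1 -> R).
Hypothesis th01 : rates th.

(** The arm of round [s] is determined by the first [s.-1] rounds, so this horizon suffices and the
    value does not depend on [T]. *)
Definition play_prob (k : 'I_K.+1) (s : nat) : R :=
  hist_mean p pol th s.-1 (fun h => (action pol h s == k)%:R).

Definition mean_plays k T : R := \sum_(1 <= s < T.+1) play_prob k s.

Lemma play_probE k s T : (0 < s <= T)%N ->
  hist_mean p pol th T (fun h => (action pol h s == k)%:R) = play_prob k s.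
Proof.
move=> sT; rewrite /play_prob (@hist_mean_stable _ _ _ _ _ _ _ _ s.-1) //; first by lia.
by move=> h x sh; rewrite action_rcons //; lia.
Qed.

Lemma play_prob_ge0 k s : 0 <= play_prob k s.
Proof. by apply: hist_mean_ge0 => //; exact: bounded_ge0_bool. Qed.

Lemma sum_indic_eq (f : 'I_K.+1 -> R) j : \sum_k f k * (j == k)%:R = f j.
Proof.
rewrite (bigD1 j) //= eqxx mulr1 big1 ?addr0 // => i.
by rewrite eq_sym => /negPf ->; rewrite mulr0.
Qed.

Lemma hist_mean_action n s (f : 'I_K.+1 -> R) : (forall k, 0 <= f k) ->
  hist_mean p pol th n (fun h => f (action pol h s)) =
  \sum_k f k * hist_mean p pol th n (fun h => (action pol h s == k)%:R).
Proof.
move=> f0; under eq_hist_mean do rewrite -sum_indic_eq.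
rewrite hist_mean_sum //; last first.
  move=> k _; apply: bounded_ge0M; first exact: bounded_ge0_cst.
  exact: bounded_ge0_bool.
by apply: eq_bigr => k _; rewrite hist_meanZ //; exact: bounded_ge0_bool.
Qed.

Lemma sum_play_prob s : \sum_k play_prob k s = 1.
Proof.
rewrite -(hist_mean_cst pol p_ge0 th01 p_sum1 s.-1 ler01).
rewrite (hist_mean_action s.-1 s (f := fun=> 1)) //.
by apply: eq_bigr => k _; rewrite mul1r.
Qed.

Lemma sum_mean_plays T : \sum_k mean_plays k T = T%:R.
Proof.
rewrite exchange_big /=; under eq_bigr do rewrite sum_play_prob.
by rewrite sumr_const_nat subn1.
Qed.

(** Given the past, conversion and delay of round [s] are independent, so censoring at [T] only
    multiplies the mean conversion by the CDF at [T - s], whatever the arm. *)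
Lemma mean_conversion s T : (0 < s <= T)%N ->
  hist_mean p pol th T (fun h =>
    ((round_of h s).1 && ((round_of h s).2 <= T - s)%N)%:R) =
  series p (T - s).+1 * \sum_k th k * play_prob k s.
Proof.
move=> /andP[s0 sT].
have W0 : 0 <= series p (T - s).+1 by rewrite seriesEnat; apply: sumr_ge0.
have th0 k : 0 <= th k by case/andP: (th01 k).
rewrite (@hist_mean_stable _ _ _ _ _ _ _ _ s) //; last first.
  by move=> h x sh; rewrite round_of_rcons // s0.
case: s s0 sT W0 => // s _ sT W0.
rewrite (@hist_mean_rcons _ _ _ _ _ _ _ s _ (fun=> 1) (fun c => c%:R)
  (fun d => (d <= T - s.+1)%N%:R) _ _ _ _ _ (@cvg_series_le _ p _)) //.
- under eq_hist_mean do rewrite mul1r mulr1 mulr0 addr0.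
  rewrite hist_meanZ //; first by rewrite hist_mean_action.
  by exists 1 => h; exact: th01.
- by move=> h x hs; rewrite -hs round_of_rcons_last mul1r -natrM mulnb.
Qed.

Lemma exp_rewardE T : fine (exp_reward th p pol T) =
  \sum_(1 <= s < T.+1) series p (T - s).+1 * \sum_k th k * play_prob k s.
Proof.
rewrite -[LHS]/(hist_mean p pol th T (fun h => cumrew h T)).
under eq_hist_mean do rewrite cumrewE.
rewrite hist_mean_sum //; last by move=> s _; exact: bounded_ge0_bool.
by apply: eq_big_nat => s sT; rewrite mean_conversion.
Qed.

End Plays.

Lemma opt_arm_max (th : 'I_K.+1 -> R) k : th k <= th (opt_arm th).
Proof. by rewrite /opt_arm; case: arg_maxP => // i _; apply. Qed.

(** Oracle and algorithm suffer the same censoring factor at round [s], so it factors out of the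
    difference of their rewards. *)
Lemma regretE (pol : policy K) (th : 'I_K.+1 -> R) T : rates th ->
  regret th p pol T = \sum_(1 <= s < T.+1) series p (T - s).+1 *
     \sum_k (th (opt_arm th) - th k) * play_prob pol th k s.
Proof.
move=> th01; rewrite /regret !exp_rewardE // -sumrB.
apply: eq_bigr => s _; rewrite -mulrBr; congr (_ * _).
under [RHS]eq_bigr do rewrite mulrBl; rewrite sumrB; congr (_ - _).
rewrite -mulr_sumr sum_play_prob // mulr1.
have th0 k : 0 <= th k by case/andP: (th01 k).
rewrite /play_prob -hist_mean_action //.
exact: (hist_mean_cst (oracle th) p_ge0 th01 p_sum1 s.-1 (th0 (opt_arm th))).
Qed.

(** Censoring hides at most [1 - series p (T - s).+1] of the mean gap of round [s], since that gap
    is at most 1; these tails add up to at most the mean delay. *)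
Lemma regret_ge (pol : policy K) (th : 'I_K.+1 -> R) T : rates th ->
  cvg (series (fun d => d%:R * p d) @ \oo) ->
  \sum_k (th (opt_arm th) - th k) * mean_plays pol th k T -
    lim (series (fun d => d%:R * p d) @ \oo) <= regret th p pol T.
Proof.
move=> th01 pm; rewrite regretE // lerBlDr.
pose x s : R := \sum_k (th (opt_arm th) - th k) * play_prob pol th k s.
have -> : \sum_k (th (opt_arm th) - th k) * mean_plays pol th k T =
    \sum_(1 <= s < T.+1) x s.
  by rewrite exchange_big /=; apply: eq_bigr => k _; rewrite mulr_sumr.
apply: (@le_trans _ _ (\sum_(1 <= s < T.+1) (series p (T - s).+1 * x s +
    (1 - series p (T - s).+1)))); last first.
  rewrite big_split /= lerD2l.
  (* Reversing time makes [T - s] run through 0 to [T.-1], as in [sum_tail_le_mean]. *)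
  rewrite big_nat_rev /= big_add1 /= add1n.
  under eq_big_nat => j jT do rewrite -[(T.+2 - _)%N]/(T.+1 - j.+1)%N.
  apply: le_trans (sum_tail_le_mean T p_ge0 p_sum1 pm).
  rewrite le_eqVlt; apply/orP; left; apply/eqP; apply: eq_big_nat => j jT.
  by congr (1 - series p _); lia.
apply: ler_sum => s _.
have le1 : series p (T - s).+1 <= 1.
  have nd : nondecreasing_seq (series p) by apply: nondecreasing_series => *.
  have := nondecreasing_cvgn_le nd (cvgP _ p_sum1) (T - s).+1.
  by rewrite (cvg_lim _ p_sum1).
have x1 : x s <= 1.
  rewrite -(sum_play_prob pol th01 s); apply: ler_sum => k _.
  rewrite ler_piMl ?play_prob_ge0 //.
  by have := th01 k; have := th01 (opt_arm th); lra.
by have := mulr_ge0 (_ : 0 <= 1 - series p (T - s).+1) (_ : 0 <= 1 - x s); nra.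
Qed.

End Regret.

(** * Change of measure between two models that differ on one arm *)

Lemma expR_chord (R : realType) (a z : R) : 0 <= z <= 1 ->
  expR (a * z) <= 1 + z * (expR a - 1).
Proof.
(* Evaluate the tangent at [a * z] at 0 and at [a], and combine with weights
   [1 - z] and [z]. *)
move=> /andP[z0 z1].
have e0 : 0 <= expR (a * z) by exact: expR_ge0.
have t0 : expR (a * z) * (1 - a * z) <= 1.
  rewrite -[leRHS](expRxMexpNx_1 (a * z)) ler_wpM2l //.
  exact: expR_ge1Dx.
have t1 : expR (a * z) * (1 + a * (1 - z)) <= expR a.
  have -> : expR a = expR (a * z) * expR (a * (1 - z)).
    by rewrite -expRD; congr expR; ring.
  by rewrite ler_wpM2l // expR_ge1Dx.
have h0 := ler_wpM2l (_ : 0 <= 1 - z) t0; have h1 := ler_wpM2l z0 t1.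
have := lerD (h0 _) h1; rewrite subr_ge0 => /(_ z1); lra.
Qed.

Section ChangeOfMeasure.
Context {R : realType} {K : nat}.
Variables (p : nat -> R) (pol : policy K).
Hypothesis p_ge0 : forall d, 0 <= p d.
Hypothesis p_sum1 : series p @ \oo --> (1 : R).
Variables (th th' : 'I_K.+1 -> R) (k : 'I_K.+1).
Hypothesis th01 : rates th.
Hypothesis th'01 : rates th'.
Hypothesis thk : 0 < th k < 1.
Hypothesis th'k : 0 < th' k < 1.
Hypothesis th_th' : forall j, j != k -> th' j = th j.
Implicit Types h : seq (bool * nat).

Definition plays h T : R := \sum_(1 <= t < T.+1) (action pol h t == k)%:R.

Definition unplayed_frac T h : R := 1 - plays h T / T%:R.

Definition llr_step (c : bool) : R := ln (bern (th k) c / bern (th' k) c).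

Definition llr h T : R :=
  \sum_(1 <= t < T.+1) (action pol h t == k)%:R * llr_step (round_of h t).1.

Lemma hist_prob_llr h :
  hist_prob th' p pol h = hist_prob th p pol h * expR (- llr h (size h)).
Proof.
have [/andP[t0 t1] /andP[t'0 t'1]] := (thk, th'k).
rewrite /hist_prob /llr -sumrN expR_sum -big_split /=.
(* Rounds on other arms have equal factors in both models. On arm [k] the delay mass is common and,
   both rates being interior, the ratio is positive, so [expR] inverts its [ln]. *)
apply: eq_bigr => t _; case: eqVneq => [->|/th_th' ->]; last first.
  by rewrite mul0r oppr0 expR0 mulr1.
rewrite mul1r expRN /llr_step lnK.
  by case: (round_of h t).1 => /=; field; rewrite !gt_eqF ?subr_gt0.
by rewrite posrE divr_gt0 //; case: (round_of h t).1; rewrite /= ?subr_gt0.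
Qed.

Lemma plays_itv h T : 0 <= plays h T <= T%:R.
Proof.
rewrite /plays; apply/andP; split; first by apply: sumr_ge0 => t _; rewrite ler0n.
have -> : T%:R = \sum_(1 <= t < T.+1) (1 : R) by rewrite sumr_const_nat subn1.
by apply: ler_sum => t _; rewrite lern1 leq_b1.
Qed.

Lemma bounded_plays T : bounded_ge0 (plays ^~ T).
Proof. by exists T%:R => h; exact: plays_itv. Qed.

Lemma unplayed_frac_itv T h : 0 <= unplayed_frac T h <= 1.
Proof.
have /andP[n0 nT] := plays_itv h T; rewrite /unplayed_frac.
rewrite subr_ge0 lerBlDr lerDl divr_ge0 // andbT.
(* At [T = 0] the quotient is 0 by the convention [0^-1 = 0]. *)
case: T n0 nT => [|T] n0 nT; first by rewrite invr0 mulr0.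
by rewrite ler_pdivrMr ?ltr0Sn // mul1r.
Qed.

Lemma bounded_unplayed_frac T : bounded_ge0 (unplayed_frac T).
Proof. by exists 1; exact: unplayed_frac_itv. Qed.

Lemma hist_mean_plays (r : 'I_K.+1 -> R) T : rates r ->
  hist_mean p pol r T (plays ^~ T) = mean_plays p pol r k T.
Proof.
move=> r01; rewrite hist_mean_sum //; last by move=> t _; exact: bounded_ge0_bool.
by apply: eq_big_nat => t tT; rewrite play_probE.
Qed.

Lemma hist_mean_unplayed_frac (r : 'I_K.+1 -> R) T : rates r ->
  hist_mean p pol r T (unplayed_frac T) = 1 - mean_plays p pol r k T / T%:R.
Proof.
move=> r01; apply/eqP; rewrite eq_sym subr_eq; apply/eqP.
rewrite -[LHS](hist_mean_cst pol p_ge0 r01 p_sum1 T ler01) -hist_mean_plays //.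
rewrite [_ / _]mulrC -hist_meanZ ?invr_ge0 //; last exact: bounded_plays.
rewrite -hist_meanD //.
- by apply: eq_hist_mean => h _; rewrite /unplayed_frac [_^-1 * _]mulrC subrK.
- exact: bounded_unplayed_frac.
- apply: bounded_ge0M; last exact: bounded_plays.
  by apply: bounded_ge0_cst; rewrite invr_ge0.
Qed.

(* [llr_bound * plays] shifts [llr] to a nonnegative variable, the only ones
   [hist_mean] handles. *)
Definition llr_bound : R := `|llr_step true| + `|llr_step false|.

Lemma llr_step_ge0 c : 0 <= llr_step c + llr_bound.
Proof.
rewrite /llr_bound; have := ler_norm (- llr_step c); rewrite normrN.
have := normr_ge0 (llr_step true); have := normr_ge0 (llr_step false).
by case: c; lra.
Qed.

Lemma llr_shiftE h T : llr h T + llr_bound * plays h T =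
  \sum_(1 <= t < T.+1) (action pol h t == k)%:R *
     (llr_step (round_of h t).1 + llr_bound).
Proof.
rewrite /plays mulr_sumr -big_split /=; apply: eq_bigr => t _; ring.
Qed.

Lemma bounded_llr_term t : bounded_ge0 (fun h => (action pol h t == k)%:R *
  (llr_step (round_of h t).1 + llr_bound)).
Proof.
apply: bounded_ge0M; first exact: bounded_ge0_bool.
exists (\sum_c (llr_step c + llr_bound)) => h; rewrite llr_step_ge0 /=.
rewrite (bigD1 (round_of h t).1) //= lerDl; apply: sumr_ge0 => c _.
exact: llr_step_ge0.
Qed.

(** A Wald identity: whether arm [k] is played at round [t] depends on the past only, and each play
    contributes on average the divergence, plus the shift. *)
Lemma hist_mean_llr T :
  hist_mean p pol th T (fun h => llr h T + llr_bound * plays h T) =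
  (klBern (th k) (th' k) + llr_bound) * mean_plays p pol th k T.
Proof.
under eq_hist_mean do rewrite llr_shiftE.
rewrite hist_mean_sum //; last by move=> t _; exact: bounded_llr_term.
rewrite /mean_plays mulr_sumr; apply: eq_big_nat => -[|t] // tT.
have klE : klBern (th k) (th' k) + llr_bound =
    th k * (llr_step true + llr_bound) + (1 - th k) * (llr_step false + llr_bound).
  by rewrite /klBern /llr_step /=; ring.
rewrite (@hist_mean_stable _ _ _ _ _ _ _ _ t.+1) //.
- rewrite (@hist_mean_rcons _ _ _ _ _ _ _ t _
    (fun h => (action pol h t.+1 == k)%:R) (fun c => llr_step c + llr_bound)
    (fun=> 1) 1) //.
  + rewrite /play_prob -hist_meanZ //.
    * apply: eq_hist_mean => h _; rewrite klE; case: eqVneq => [->|_] /=; ring.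
    * have /andP[t0 t1] := th01 k.
      by rewrite klE addr_ge0 // mulr_ge0 ?llr_step_ge0 // subr_ge0.
    * exact: bounded_ge0_bool.
  + by move=> h; rewrite mulr_ge0 // llr_step_ge0.
  + exact: llr_step_ge0.
  + by under eq_fun do rewrite mulr1.
  + by move=> h x <-; rewrite round_of_rcons_last action_rcons // mulr1.
- by move=> h; rewrite mulr_ge0 // llr_step_ge0.
- by move=> h x sh; rewrite round_of_rcons ?action_rcons //; lia.
Qed.

Lemma change_of_measure T (a : R) : 0 <= a ->
  a * (1 - mean_plays p pol th k T / T%:R) <=
  expR a * (1 - mean_plays p pol th' k T / T%:R) +
  klBern (th k) (th' k) * mean_plays p pol th k T.
Proof.
move=> a0; rewrite -!hist_mean_unplayed_frac //.
set Z := unplayed_frac T; set kl := klBern _ _; set N := mean_plays _ _ _ _ _.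
have bZ : bounded_ge0 Z by exact: bounded_unplayed_frac.
have M0 : 0 <= llr_bound by rewrite addr_ge0.
(* The inequality to integrate is [F <= expR (- llr) * G + H], with [llr_bound * plays] added on
   both sides to keep every term nonnegative. The weight [expR (- llr)] turns the mean of [G] under
   [th] into its mean under [th']. *)
pose F h := a * Z h + (1 + llr_bound * plays h T).
pose G h := 1 + expR a * Z h.
pose H h := llr h T + llr_bound * plays h T.
have bcZ (c : R) : 0 <= c -> bounded_ge0 (fun h => c * Z h).
  by move=> c0; apply: bounded_ge0M => //; exact: bounded_ge0_cst.
have bMN : bounded_ge0 (fun h => llr_bound * plays h T).
  by apply: bounded_ge0M; [exact: bounded_ge0_cst|exact: bounded_plays].
have b1 : @bounded_ge0 R (fun=> 1) by exact: bounded_ge0_cst.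
have bF : bounded_ge0 F by apply: bounded_ge0D; [exact: bcZ|exact: bounded_ge0D].
have bG : bounded_ge0 G by apply: bounded_ge0D => //; apply: bcZ; exact: expR_ge0.
have bH : bounded_ge0 H.
  rewrite (_ : H = fun h => \sum_(1 <= t < T.+1) (action pol h t == k)%:R *
     (llr_step (round_of h t).1 + llr_bound)).
    by apply: bounded_ge0_sum => t _; exact: bounded_llr_term.
  by apply/funext => h; exact: llr_shiftE.
have : hist_mean p pol th T F <= hist_mean p pol th' T G + hist_mean p pol th T H.
  rewrite /hist_mean -fineD ?esum_hist_fin // -esumD.
  - apply: fine_le.
    + exact: esum_hist_fin.
    + rewrite esumD ?fin_numD ?esum_hist_fin // => h _;
        by rewrite lee_fin mulr_ge0 ?hist_prob_ge0 // bounded_ge0_ge.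
    + apply: le_esum => h /= hT; rewrite -EFinD lee_fin hist_prob_llr hT.
      (* [1 + u <= expR u] at [u = a * Z h - llr h T] *)
      have P0 := hist_prob_ge0 pol p_ge0 h th01.
      rewrite -mulrA -mulrDr ler_wpM2l // /F /G /H.
      have e1 := expR_ge1Dx (- llr h T + a * Z h).
      have e2 := ler_wpM2l (expR_ge0 (- llr h T)) (expR_chord a (unplayed_frac_itv T h)).
      rewrite expRD in e1.
      have /andP[Z0 _] := unplayed_frac_itv T h.
      (* This nonnegative term is what is given up in replacing [expR a - 1] by [expR a] in the
         chord bound. *)
      have := mulr_ge0 (expR_ge0 (- llr h T)) Z0.
      by rewrite -/(Z h) in e2 Z0 *; nra.
  - by move=> h _; rewrite lee_fin mulr_ge0 ?hist_prob_ge0 // bounded_ge0_ge.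
  - by move=> h _; rewrite lee_fin mulr_ge0 ?hist_prob_ge0 // bounded_ge0_ge.
have -> : hist_mean p pol th T F =
    a * hist_mean p pol th T Z + (1 + llr_bound * N).
  rewrite hist_meanD ?hist_meanZ //; [|exact: bcZ|exact: bounded_ge0D].
  congr (_ + _); rewrite hist_meanD // hist_mean_cst // hist_meanZ ?hist_mean_plays //.
  exact: bounded_plays.
have -> : hist_mean p pol th' T G = 1 + expR a * hist_mean p pol th' T Z.
  have e0 := expR_ge0 a.
  by rewrite hist_meanD ?hist_meanZ ?hist_mean_cst //; exact: bcZ.
by rewrite hist_mean_llr -/N -/kl; lra.
Qed.

End ChangeOfMeasure.

(** * Bernoulli divergence and growth estimates *)

Lemma klBern_gt0 (R : realType) (x y : R) : 0 < x -> x < y -> y < 1 ->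
  0 < klBern x y.
Proof.
move=> x0 xy y1; have y0 : 0 < y by exact: lt_trans xy.
have x1 : x < 1 by exact: lt_trans y1.
have x'0 : 0 < 1 - x by rewrite subr_gt0.
have y'0 : 0 < 1 - y by rewrite subr_gt0.
(* Applied to the two likelihood ratios, this gives strict lower bounds whose average under [x] is
   [(x - y) + (y - x) = 0]. *)
have ln_gt (u : R) : 0 < u -> u != 1 -> 1 - u^-1 < ln u.
  move=> u0 u1; have := @expR_gt1Dx _ (- ln u).
  rewrite oppr_eq0 ln_eq0 // => /(_ u1).
  by rewrite expRN lnK ?posrE //; lra.
have h1 : 1 - y / x < ln (x / y).
  by rewrite -invf_div; apply: ln_gt; rewrite ?divr_gt0 // lt_eqF // ltr_pdivrMr // mul1r.
have h2 : 1 - (1 - y) / (1 - x) < ln ((1 - x) / (1 - y)).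
  rewrite -invf_div; apply: ln_gt; rewrite ?divr_gt0 // gt_eqF // ltr_pdivlMr //.
  by rewrite mul1r ltrD2l ltrN2.
rewrite -(ltr_pM2l x0) in h1; rewrite -(ltr_pM2l x'0) in h2.
have e1 : x * (1 - y / x) = x - y by field; rewrite gt_eqF.
have e2 : (1 - x) * (1 - (1 - y) / (1 - x)) = y - x by field; rewrite gt_eqF.
by rewrite e1 in h1; rewrite e2 in h2; rewrite /klBern; lra.
Qed.

Lemma continuous_klBern (R : realType) (x y : R) : 0 < x < 1 -> 0 < y < 1 ->
  {for y, continuous (klBern x)}.
Proof.
move=> /andP[x0 x1] /andP[y0 y1]; have y'0 : 0 < 1 - y by rewrite subr_gt0.
have x'0 : 0 < 1 - x by rewrite subr_gt0.
have c1 : 1 - z @[z --> y] --> 1 - y by apply: cvgB; [exact: cvg_cst|exact: cvg_id].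
have div_cvg (a b : R) (f : R -> R) : b != 0 -> f z @[z --> y] --> b ->
    a / f z @[z --> y] --> a / b.
  by move=> b0 fb; apply: cvgM; [exact: cvg_cst|exact: cvgV].
apply: cvgD; apply: cvgM; try exact: cvg_cst.
  apply: (cvg_comp _ _ (div_cvg x _ _ _ cvg_id)); first by rewrite gt_eqF.
  by apply: continuous_ln; rewrite divr_gt0.
apply: (cvg_comp _ _ (div_cvg (1 - x) _ _ _ c1)); first by rewrite gt_eqF.
by apply: continuous_ln; rewrite divr_gt0.
Qed.

Lemma near_ln_ge (R : realType) (A : R) : \forall n \near \oo, A <= ln n%:R.
Proof.
near=> n.
have An : expR A <= n%:R by near: n; exact: nbhs_infty_ger.
rewrite -ler_expR lnK // posrE; apply: lt_le_trans An; exact: expR_gt0.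
Unshelve. all: by end_near. Qed.

Lemma near_powR_ge (R : realType) (alpha A : R) : 0 < alpha ->
  \forall n \near \oo, A <= n%:R `^ alpha.
Proof.
move=> al0; near=> n.
have n0 : (0 < n)%N by near: n; exact: nbhs_infty_gt.
have Aln : A / alpha <= ln n%:R by near: n; exact: near_ln_ge.
rewrite /powR pnatr_eq0 eqn0Ngt n0 /=.
apply: le_trans (expR_ge1Dx _).
rewrite ler_pdivrMr // in Aln; lra.
Unshelve. all: by end_near. Qed.

Lemma limn_einf_ge (R : realType) (u : nat -> \bar R) (x : \bar R) :
  (\forall n \near \oo, (x <= u n)%E) -> (x <= limn_einf u)%E.
Proof.
move=> [N _ xu]; rewrite limn_einf_lim; apply: lime_ge; first exact: is_cvg_einfs.
exists N => // n /= Nn; apply: le_ereal_inf_tmp => _ [m /= nm <-].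
by apply: xu => /=; exact: leq_trans nm.
Qed.

(** * Lower bounds on suboptimal plays under uniform efficiency *)

Section Asymptotics.
Context {R : realType} {K : nat}.
Variables (p : nat -> R) (pol : policy K).
Hypothesis p_ge0 : forall d, 0 <= p d.
Hypothesis p_sum1 : series p @ \oo --> (1 : R).
Hypothesis p_mean : cvg (series (fun d => d%:R * p d) @ \oo).
Hypothesis pol_ue : uniformly_efficient p pol.

Let mu := lim (series (fun d => d%:R * p d) @ \oo).

Lemma mean_plays_ge0 (r : 'I_K.+1 -> R) k T : rates r ->
  0 <= mean_plays p pol r k T.
Proof. by move=> r01; apply: sumr_ge0 => t _; exact: play_prob_ge0. Qed.

Lemma regret_opt_ge (r : 'I_K.+1 -> R) j T : rates r -> (forall i, r i <= r j) ->
  \sum_i (r j - r i) * mean_plays p pol r i T - mu <= regret r p pol T.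
Proof.
move=> r01 rj; have -> : r j = r (opt_arm r).
  by apply/eqP; rewrite eq_le opt_arm_max rj.
exact: regret_ge.
Qed.

(** Each play of an arm other than [j] costs at least the smallest gap, so the expected number of
    such plays is at most regret plus mean delay, divided by that gap. *)
Lemma near_suboptimal_plays (r : 'I_K.+1 -> R) j (alpha e : R) : rates r ->
  (forall i, i != j -> r i < r j) -> 0 < alpha < 1 -> 0 < e ->
  \forall T \near \oo, T%:R - mean_plays p pol r j T <= e * T%:R `^ alpha.
Proof.
move=> r01 rj al01 e0; have /andP[al0 _] := al01.
(* The default 1 keeps [gap] positive even if [j] is the only arm. *)
pose gap : R := \big[Order.min/1]_(i | i != j) (r j - r i).
have gap0 : 0 < gap by apply: lt_bigmin => // i ij; rewrite subr_gt0 rj.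
have rj' i : r i <= r j by case: (eqVneq i j) => [->//|/rj /ltW].
(* Half of the budget [e * gap] is for the regret, half for the mean delay. *)
have e20 : 0 < e * gap / 2 by rewrite divr_gt0 // mulr_gt0.
have eff := pol_ue r01 al01.
near=> T.
have Ta : mu / (e * gap / 2) <= T%:R `^ alpha by near: T; exact: near_powR_ge.
have Ta1 : 1 <= T%:R `^ alpha :> R by near: T; exact: near_powR_ge.
have Ta0 : 0 < T%:R `^ alpha :> R by exact: lt_le_trans Ta1.
have : `|regret r p pol T / T%:R `^ alpha| <= e * gap / 2.
  by near: T; exact: cvgr0_norm_le.
move=> /(le_trans (ler_norm _)); rewrite ler_pdivrMr // => reg.
rewrite ler_pdivrMr // in Ta.
have := regret_opt_ge T r01 rj'.
have : gap * (T%:R - mean_plays p pol r j T) <=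
    \sum_i (r j - r i) * mean_plays p pol r i T.
  rewrite -(sum_mean_plays p_ge0 p_sum1 pol r01) (bigD1 j) //= addrAC subrr add0r.
  rewrite mulr_sumr [leRHS](bigD1 j) //= subrr mul0r add0r.
  apply: ler_sum => i ij; rewrite ler_wpM2r ?mean_plays_ge0 //.
  exact: bigmin_le_cond.
move=> h1 h2; rewrite -(ler_pM2l gap0).
apply: le_trans h1 _; move: h2 reg Ta; set S := \sum_(_ <- _) _; lra.
Unshelve. all: by end_near. Qed.

Section Arm.
Variable th : 'I_K.+1 -> R.
Hypothesis th01 : forall k, 0 < th k < 1.
Hypothesis th_opt : forall k, k != ord0 -> th k < th ord0.
Variable k : 'I_K.+1.
Hypothesis k0 : k != ord0.

Let th_rates : rates th.
Proof. by move=> j; have /andP[/ltW -> /ltW ->] := th01 j. Qed.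

(** Efficiency is used twice. Under [th'] arm [k] is optimal, so with [a = (1 - d) ln T] the term
    [expR a * E'[Z]] is at most 1. Under [th] it is suboptimal, so [E[Z] >= 1 - d]. This leaves
    [(1 - d)^2 ln T - 1]; the 1 is absorbed by [d * ln T], hence the constant 3. *)
Lemma near_plays_kl (lam d : R) : th ord0 < lam < 1 -> 0 < d < 1 ->
  \forall T \near \oo,
    (1 - 3 * d) * ln T%:R <= klBern (th k) lam * mean_plays p pol th k T.
Proof.
move=> /andP[lam0 lam1] d01; have /andP[d0 d1] := d01.
pose th' j := if j == k then lam else th j.
have lam01 : 0 < lam < 1.
  by rewrite lam1 andbT (lt_trans _ lam0) //; case/andP: (th01 ord0).
have th'01 : rates th'.
  move=> j; rewrite /th'; case: ifP => _; last exact: th_rates.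
  by have /andP[/ltW -> /ltW ->] := lam01.
have th'k : th' k = lam by rewrite /th' eqxx.
have th'_opt i : i != k -> th' i < th' k.
  rewrite th'k /th' => /negPf ->; apply: le_lt_trans lam0.
  by case: (eqVneq i ord0) => [->//|/th_opt /ltW].
have near1 := near_suboptimal_plays th'01 th'_opt d01 ltr01.
have half01 : 0 < (2^-1 : R) < 1 by lra.
have near2 := near_suboptimal_plays th_rates th_opt half01 d0.
near=> T.
have lnT : d^-1 <= ln T%:R by near: T; exact: near_ln_ge.
have T0 : (0 < T)%N by near: T; exact: nbhs_infty_gt.
have TR0 : 0 < T%:R :> R by rewrite ltr0n.
have n1 : T%:R - mean_plays p pol th ord0 T <= d * T%:R `^ 2^-1 by near: T.
have n2 : T%:R - mean_plays p pol th' k T <= 1 * T%:R `^ d by near: T.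
have lnT0 : 0 <= ln T%:R :> R by rewrite ln_ge0 // ler1n.
have th'th j : j != k -> th' j = th j by rewrite /th' => /negPf ->.
have a0 : 0 <= (1 - d) * ln T%:R by rewrite mulr_ge0 //; lra.
have := @change_of_measure _ _ p pol p_ge0 p_sum1 th th' k th_rates th'01
  (th01 k) _ th'th T _ a0.
rewrite th'k => /(_ lam01) cm.
have Nk : mean_plays p pol th k T / T%:R <= d.
  rewrite ler_pdivrMr //; apply: le_trans (_ : d * T%:R `^ 2^-1 <= _).
    apply: le_trans n1; have := sum_mean_plays p_ge0 p_sum1 pol th_rates T.
    rewrite (bigD1 ord0) //= (bigD1 k) //= => <-; rewrite addrAC subrr add0r lerDl.
    by apply: sumr_ge0 => i _; exact: mean_plays_ge0.
  rewrite (ler_wpM2l (ltW d0)) // -[leRHS]powRr1 ?ler0n //.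
  by apply: ler_powR; [rewrite ler1n|lra].
have E : expR ((1 - d) * ln T%:R) * (1 - mean_plays p pol th' k T / T%:R) <= 1.
  have -> : expR ((1 - d) * ln T%:R) = T%:R / T%:R `^ d :> R.
    by rewrite /powR gt_eqF // mulrBl mul1r expRB lnK.
  have Td0 : 0 < T%:R `^ d :> R by exact: powR_gt0.
  have -> : T%:R / T%:R `^ d * (1 - mean_plays p pol th' k T / T%:R) =
     (T%:R - mean_plays p pol th' k T) / T%:R `^ d.
    by field; rewrite !gt_eqF.
  by rewrite ler_pdivrMr.
have d1lnT : 1 <= d * ln T%:R.
  by rewrite mulrC -ler_pdivrMr // div1r.
have : (1 - d) * ln T%:R * (1 - d) <=
   (1 - d) * ln T%:R * (1 - mean_plays p pol th k T / T%:R).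
  by apply: ler_wpM2l; [rewrite mulr_ge0 //; lra|lra].
have := mulr_ge0 (mulr_ge0 (ltW d0) (ltW d0)) lnT0.
lra.
Unshelve. all: by end_near. Qed.

Lemma near_plays_ge (e : R) : 0 < e ->
  \forall T \near \oo,
    (klBern (th k) (th ord0))^-1 - e <= mean_plays p pol th k T / ln T%:R.
Proof.
move=> e0; set kl := klBern _ _.
have /andP[t0 t1] := th01 ord0.
have kl0 : 0 < kl by apply: klBern_gt0 => //; [case/andP: (th01 k)|exact: th_opt].
(* With [x] the normalized number of plays, the goal times [kl] reads [1 - e * kl <= x * kl]. Half
   of the error [e * kl] covers [3 * d], the other half covers [eta * x] when [x * kl < 1]. *)
pose eta := e * kl ^+ 2 / 2; pose d := Num.min (e * kl / 6) (1 / 2).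
have eta0 : 0 < eta by rewrite divr_gt0 // mulr_gt0 // exprn_gt0.
have d01 : 0 < d < 1.
  by rewrite lt_min gt_min !divr_gt0 ?mulr_gt0 //=; apply/orP; right; lra.
have d6 : d <= e * kl / 6 by rewrite ge_min lexx.
have [lam lam01 lam_kl] : exists2 lam, th ord0 < lam < 1 &
    klBern (th k) lam <= kl + eta.
  have c := cvg_at_right_filter (continuous_klBern (th01 k) (th01 ord0)).
  have : \forall l \near (th ord0)^'+, klBern (th k) l <= kl + eta.
    by apply: (cvgr_le _ c); rewrite ltrDl.
  move=> H; have : \forall l \near (th ord0)^'+,
      th ord0 < l < 1 /\ klBern (th k) l <= kl + eta.
    near=> l; split; last by near: l.
    apply/andP; split; near: l; first exact: nbhs_right_gt.
    exact: nbhs_right_lt.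
  by move=> /filter_ex[l [? ?]]; exists l.
have near1 := near_plays_kl lam01 d01.
near=> T.
have lnT : 1 <= ln T%:R :> R by near: T; exact: near_ln_ge.
have lnT0 : 0 < ln T%:R :> R by exact: lt_le_trans lnT.
have : (1 - 3 * d) * ln T%:R <= klBern (th k) lam * mean_plays p pol th k T.
  by near: T.
rewrite -ler_pdivlMr // -mulrA; set x := _ / _ => Hx.
have x0 : 0 <= x by rewrite divr_ge0 ?mean_plays_ge0 // ltW.
(* If [x] already reaches [kl^-1] nothing remains; otherwise [x * kl < 1] controls [eta * x]. *)
have [//|xkl] := leP kl^-1 x; first by move=> ?; rewrite lerBlDr; lra.
have h1 := ler_wpM2r x0 lam_kl.
have h2 : x * kl < 1 by rewrite -ltr_pdivlMr // div1r.
rewrite lerBlDr -(ler_pM2r kl0) mulVf ?gt_eqF // mulrDl.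
have h3 : eta * x <= e * kl / 2.
  rewrite /eta expr2 (_ : _ * x = (e * kl / 2) * (x * kl)); last by ring.
  by apply: ler_piMr; [rewrite divr_ge0 // mulr_ge0 // ltW|exact: ltW].
lra.
Unshelve. all: by end_near. Qed.

End Arm.
End Asymptotics.

(* Arms are 'I_K.+1; ord0 plays the role of the paper's arm 1. *)
Theorem theorem4 (R : realType) (K : nat) (p : nat -> R)
  (p_ge0 : forall d, 0 <= p d)
  (p_sum1 : series p @ \oo --> (1 : R))
  (p_mean : cvg (series (fun d => d%:R * p d) @ \oo))
  (th : 'I_K.+1 -> R)
  (th01 : forall k, 0 < th k < 1)
  (th_opt : forall k, k != ord0 -> th k < th ord0)
  (pol : policy K)
  (pol_ue : uniformly_efficient p pol) :
  ((\sum_(k < K.+1 | k != ord0) (th ord0 - th k) / klBern (th k) (th ord0))%:E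
    <= limn_einf (fun T : nat => (regret th p pol T / ln (T%:R : R))%:E))%E.
Proof.
have th_rates : rates th by move=> j; have /andP[/ltW -> /ltW ->] := th01 j.
have th_max i : th i <= th ord0.
  by case: (eqVneq i ord0) => [->//|/th_opt /ltW].
apply/lee_subgt0Pr => e e0; apply: limn_einf_ge.
(* The error [e] is shared out: one part [e / n] per suboptimal arm, whose number is bounded by
   [K.+1], and one for the mean delay. *)
pose n : R := K.+2%:R; have n0 : 0 < n by rewrite ltr0n.
have en0 : 0 < e / n by rewrite divr_gt0.
pose mu := lim (series (fun d => d%:R * p d) @ \oo).
have plays_ge : \forall T \near \oo, forall k, k != ord0 ->
    (klBern (th k) (th ord0))^-1 - e / n <= mean_plays p pol th k T / ln T%:R.
  apply: filter_forall => k; case: (eqVneq k ord0) => [_|k0].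
    by near=> T.
  have := near_plays_ge p_ge0 p_sum1 p_mean pol_ue th01 th_opt k0 en0.
  by apply: filterS.
near=> T.
have plT : forall k, k != ord0 ->
    (klBern (th k) (th ord0))^-1 - e / n <= mean_plays p pol th k T / ln T%:R.
  by near: T.
have lnT : 1 <= ln T%:R :> R by near: T; exact: near_ln_ge.
have lnmu : mu / (e / n) <= ln T%:R by near: T; exact: near_ln_ge.
have lnT0 : 0 < ln T%:R :> R by exact: lt_le_trans lnT.
rewrite -EFinB lee_fin.
apply: le_trans (_ : (\sum_k (th ord0 - th k) * mean_plays p pol th k T - mu)
    / ln T%:R <= _); last first.
  by rewrite ler_wpM2r ?invr_ge0 ?(ltW lnT0) // regret_opt_ge.
rewrite mulrBl; apply: le_trans (_ : \sum_(k < K.+1 | k != ord0)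
    ((th ord0 - th k) / klBern (th k) (th ord0) - e / n) - e / n <= _); last first.
  apply: lerB; last by rewrite ler_pdivrMr // mulrC -ler_pdivrMr.
  rewrite mulr_suml [leRHS](bigD1 ord0) //= subrr !mul0r add0r.
  apply: ler_sum => k k0; rewrite -mulrA.
  have d0 : 0 <= th ord0 - th k by rewrite subr_ge0.
  have d1 : th ord0 - th k <= 1.
    by have /andP[? ?] := th01 ord0; have /andP[? ?] := th01 k; lra.
  (* Since the gap is at most 1, multiplying by it does not enlarge the error [e / n]. *)
  have := ler_wpM2l d0 (plT k k0); have := ler_wpM2r (ltW en0) d1.
  rewrite mul1r mulrBr => h1; apply: le_trans; exact: lerB.
rewrite sumrB -addrA lerD2l -opprD lerN2 -[leRHS](@divfK _ n) ?gt_eqF //.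
rewrite sumr_const -mulrSr -mulr_natr ler_wpM2l ?(ltW en0) // ler_nat ltnS.
by rewrite -[leqRHS]card_ord max_card.
Unshelve. all: by end_near. Qed.
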